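(* Let $d\ge2$, $A\in\mathcal C^{d-1}$ and $C\in\mathcal C^d_A$. Then for every $a\in[0,\tfrac12]$, $$\mu_A\Big(\big\{\mathbf x\in\mathbb I^{d-1}: |r_C(\mathbf x)-\tfrac12|\ge a\big\}\Big)\le\min\{1,\,2-4a\}.$$
   Context: $\mathbb I=[0,1]$, $\lambda$ Lebesgue measure. A $d$-copula $C\in\mathcal C^d$ is the distribution function on $\mathbb I^d$ of a probability measure $\mu_C$ with uniform univariate marginals; points are $(\mathbf x,y)$, $\mathbf x\in\mathbb I^{d-1}$. $C_{1:(d-1)}$ is the marginal copula of the first $d-1$ coordinates. For $A\in\mathcal C^{d-1}$, $\mathcal C^d_A=\{C\in\mathcal C^d: C_{1:(d-1)}=A\}$; for $d=2$, $\mu_A=\lambda$ and $\mathcal C^2_A=\mathcal C^2$. $K_C$ is the Markov kernel of $C$ w.r.t. the first $d-1$ coordinates: $\mu_C(B\times F)=\int_B K_C(\mathbf x,F)\,\mathrm d\mu_{C_{1:(d-1)}}(\mathbf x)$. Regression function $r_C(\mathbf x)=\int y\,K_C(\mathbf x,\mathrm dy)$. *)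

(* Defs.v *)
From HB Require Import structures.
From mathcomp Require Import all_boot all_order all_algebra.
From mathcomp Require Import all_classical all_reals all_analysis.
Set Implicit Arguments. Unset Strict Implicit. Unset Printing Implicit Defensive.
Import Order.TTheory GRing.Theory Num.Theory.
Local Open Scope classical_set_scope.
Local Open Scope ring_scope.

(* An n-copula is identified with its probability measure mu_C on R^n
   (points are n-tuples, product sigma-algebra) all of whose n univariate
   marginals are the uniform distribution on I = [0,1] (Lebesgue measure
   restricted to I).  The copula C itself is the distribution function
   u |-> mu_C(prod_i [0,u_i]) of this measure; copulas and such measures
   are in one-to-one correspondence. *)
Definition is_copula_measure (R : realType) (n : nat)
    (mu : probability (n.-tuple R) R) : Prop :=
  forall (i : 'I_n) (B : set R), measurable B ->
    mu ((fun x : n.-tuple R => tnth x i) @^-1` B) =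
    (@lebesgue_measure R) (B `&` `[0%R, 1%R]).

Definition is_copula_measure_split (R : realType) (m : nat)
    (mu : probability (m.-tuple R * R)%type R) : Prop :=
  (forall (i : 'I_m) (B : set R), measurable B ->
    mu ((fun z : m.-tuple R * R => tnth z.1 i) @^-1` B) =
    (@lebesgue_measure R) (B `&` `[0%R, 1%R]))
  /\
  (forall (B : set R), measurable B ->
    mu ((fun z : m.-tuple R * R => z.2) @^-1` B) =
    (@lebesgue_measure R) (B `&` `[0%R, 1%R])).

Definition has_marginal (R : realType) (m : nat)
    (muC : probability (m.-tuple R * R)%type R)
    (muA : probability (m.-tuple R) R) : Prop :=
  forall S : set (m.-tuple R), measurable S -> muC (S `*` setT) = muA S.

Definition is_markov_kernel_of (R : realType) (m : nat)
    (muC : probability (m.-tuple R * R)%type R)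
    (muA : probability (m.-tuple R) R)
    (K : R.-pker (m.-tuple R) ~> R) : Prop :=
  forall (B : set (m.-tuple R)) (F : set R), measurable B -> measurable F ->
    muC (B `*` F) = (\int[muA]_(x in B) K x F)%E.

Definition regression (R : realType) (m : nat)
    (K : R.-pker (m.-tuple R) ~> R) (x : m.-tuple R) : \bar R :=
  (\int[K x]_y (y%:E))%E.

(* Main.v *)
(** Fix [t] in [0,1].  Pointwise, [r(x) - t] is at most the integral of
    [(y - t)^+] against [K x], and the average of the latter over [x] is the
    integral of [(y - t)^+] over [0,1], because the last marginal is uniform;
    hence [(1/2 + a - t) u <= (1 - t)^2 / 2] for the measure [u] of
    [{r >= 1/2 + a}].  The choice [t = 1 - u] gives [u <= 1 - 2 a].  The set
    [{r <= 1/2 - a}] is treated symmetrically with [(t - y)^+]. *)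
Require Import Defs.
From HB Require Import structures.
From mathcomp Require Import all_boot all_order all_algebra.
From mathcomp Require Import all_classical all_reals all_analysis.
From mathcomp Require Import measurable_realfun ring lra.
Import Order.TTheory GRing.Theory Num.Theory.
Import numFieldNormedType.Exports.
Local Open Scope classical_set_scope.
Local Open Scope ring_scope.

Set Implicit Arguments.
Unset Strict Implicit.

(** * Integration against kernels and restricted measures *)

Lemma integral_pker (d1 d2 : measure_display) (X : measurableType d1)
    (Y : measurableType d2) (R : realType) (mu : probability X R)
    (K : R.-pker X ~> Y) (nu : {measure set Y -> \bar R}) (h : Y -> \bar R) :
  (forall F, measurable F -> nu F = \int[mu]_x K x F)%E ->
  (forall y, 0 <= h y)%E -> measurable_fun [set: Y] h ->
  (\int[mu]_x \int[K x]_y h y = \int[nu]_y h y)%E.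
Proof.
move=> nuE h0 mh.
(* A probability measure is a kernel from the one-point space [unit], so the iterated integral is
   one against a composition of kernels, whose values on measurable sets are those of [nu]. *)
have mcst : measurable_fun [set: unit] (cst (mu : pprobability X R)).
  exact: measurable_cst.
have <- := @integral_kcomp _ _ _ unit _ _ _ (kprobability mcst)
  (kernel.kernel_snd (T0 := unit) K) tt h h0 mh.
by apply: eq_measure_integral => A mA _; rewrite nuE.
Qed.

Lemma integral_mrestr (d : measure_display) (X : measurableType d)
    (R : realType) (mu : {measure set X -> \bar R}) (D : set X)
    (mD : measurable D) (h : X -> \bar R) :
  (forall x, 0 <= h x)%E -> measurable_fun [set: X] h ->
  (\int[mrestr mu mD]_x h x = \int[mu]_(x in D) h x)%E.
Proof.
move=> h0 mh.
rewrite [LHS](@ge0_negligible_integral _ _ _ _ _ (~` D)) //.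
- rewrite setTD setCK.
  by apply: eq_measure_integral => A mA AD; rewrite /= /mrestr setIidl.
- exact: measurableC.
- by rewrite /= /mrestr setICl measure0.
Qed.

(** * Integrals of truncated affine functions *)

(** The slope [s] will be 1 or -1, one sign for each truncation. The fundamental theorem is applied
    on a nondegenerate interval, hence [t < 1] and [0 < t] in the next two lemmas. *)
Lemma integral_affine (R : realType) (s c a b : R) : a < b ->
  (\int[lebesgue_measure]_(y in `[a, b]) (s * (y - c))%:E
   = (s * ((b - c) ^+ 2 - (a - c) ^+ 2) / 2)%:E)%E.
Proof.
move=> ab; pose F (y : R) := s / 2 * (y - c) ^+ 2.
have dF : forall z : R, is_derive z 1 F (s * (z - c)).
  by move=> z; apply: is_derive_eq; rewrite /GRing.scale/=; field.
have cF : continuous F.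
  by move=> z; apply: differentiable_continuous; apply/derivable1_diffP.
have -> : (s * ((b - c) ^+ 2 - (a - c) ^+ 2) / 2)%:E = ((F b)%:E - (F a)%:E)%E.
  by rewrite /F -EFinB; congr (_%:E); field.
apply: (@continuous_FTC2 R) => //.
- apply: continuous_subspaceT => y.
  apply: cvgM; first exact: cvg_cst.
  by apply: cvgB; [exact: cvg_id|exact: cvg_cst].
- split=> [y _||]; first by [].
  + by apply: cvg_at_right_filter; exact: cF.
  + by apply: cvg_at_left_filter; exact: cF.
- by move=> y _; rewrite derive1E derive_val.
Qed.

Lemma integral_maxr0_subl (R : realType) (t : R) : 0 <= t -> t < 1 ->
  (\int[lebesgue_measure]_(y in `[0%R, 1%R]) (Num.max 0 (y - t))%:E
   = ((1 - t) ^+ 2 / 2)%:E)%E.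
Proof.
move=> t0 t1.
transitivity (\int[lebesgue_measure]_(y in `[t, 1%R]) (1 * (y - t))%:E)%E.
  rewrite integral_mkcond [RHS]integral_mkcond; apply: eq_integral => y _.
  rewrite !patchE !mem_setE !in_itv/= mul1r.
  have [yt|yt] := leP t y.
    by rewrite max_r ?subr_ge0// (le_trans t0 yt).
  by rewrite max_l ?subr_le0 ?(ltW yt)// if_same.
by apply: (etrans (integral_affine 1 t t1)); congr (_%:E); field.
Qed.

Lemma integral_maxr0_subr (R : realType) (t : R) : 0 < t -> t <= 1 ->
  (\int[lebesgue_measure]_(y in `[0%R, 1%R]) (Num.max 0 (t - y))%:E
   = (t ^+ 2 / 2)%:E)%E.
Proof.
move=> t0 t1.
transitivity (\int[lebesgue_measure]_(y in `[0%R, t]) (-1 * (y - t))%:E)%E.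
  rewrite integral_mkcond [RHS]integral_mkcond; apply: eq_integral => y _.
  rewrite !patchE !mem_setE !in_itv/= mulN1r opprB.
  have [yt|yt] := leP y t.
    by rewrite max_r ?subr_ge0// (le_trans yt t1).
  by rewrite max_l ?subr_le0 ?(ltW yt)// andbF if_same.
by apply: (etrans (integral_affine (-1) t t0)); congr (_%:E); field.
Qed.

(** * Averaging over the conditioning variable *)

Lemma copula_kernel_markov (R : realType) (m : nat)
  (muA : probability (m.-tuple R) R)
  (muC : probability (m.-tuple R * R)%type R)
  (K : R.-pker (m.-tuple R) ~> R) (h : R -> \bar R) (S : set (m.-tuple R))
  (c : R) :
  is_copula_measure_split muC -> is_markov_kernel_of muC muA K ->
  (forall y, 0 <= h y)%E -> measurable_fun [set: R] h -> measurable S ->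
  0 <= c ->
  (forall x, S x -> c%:E <= \int[K x]_y h y)%E ->
  (c%:E * muA S <= \int[lebesgue_measure]_(y in `[0%R, 1%R]) h y)%E.
Proof.
move=> [_ hC] hK h0 mh mS c0 hS.
have m01 : measurable (`[0%R, 1%R]%classic : set (measurableTypeR R)).
  exact: measurable_itv.
(* [lebesgue_measure] lives on [measurableTypeR R], whose display differs from
   the one of [R]; the push-forward by the identity transports it. *)
have mid : measurable_fun [set: measurableTypeR R]
    (idfun : measurableTypeR R -> R).
  by move=> _ B mB; rewrite setTI.
pose idm : {mfun measurableTypeR R >-> R} :=
  HB.pack (idfun : measurableTypeR R -> R)
    (isMeasurableFun.Build _ _ _ _ _ mid).
pose l01 := mrestr (@lebesgue_measure R) m01.
have -> : (\int[lebesgue_measure]_(y in `[0%R, 1%R]) h y =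
    \int[muA]_x \int[K x]_y h y)%E.
  rewrite (integral_pker (nu := pushforward l01 idm))//; last first.
    (* The uniform last marginal enters here: the preimage of [F] is the cylinder [setT * F], which
       the kernel disintegrates. *)
    by move=> F mF; rewrite /= /pushforward /l01 /mrestr -hC// -setTX hK.
  rewrite ge0_integral_pushforward//=.
  apply/esym.
  by apply: (@integral_mrestr _ (measurableTypeR R) R lebesgue_measure _ m01 h).
(* Markov's inequality: compare with the constant [c] on [S], then enlarge [S] to the whole
   space. *)
rewrite -integral_cst//.
have mI : measurable_fun setT (fun x => \int[K x]_y h y)%E.
  apply: measurable_fun_integral_kernel => // U mU.
  exact: measurable_kernel.
apply: (@le_trans _ _ (\int[muA]_(x in S) \int[K x]_y h y)%E).
  by apply: ge0_le_integral => //=; exact: measurable_funTS.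
apply: ge0_subset_integral => // x _; exact: integral_ge0.
Qed.

(** * Pointwise bounds and measurability of the regression function *)

Lemma measurable_maxr0 (R : realType) (f : R -> R) :
  measurable_fun [set: R] f ->
  measurable_fun [set: R] (fun y => (Num.max 0 (f y))%:E).
Proof.
by move=> mf; apply/measurable_EFinP; exact: measurable_maxr.
Qed.

(** Reduces later arguments to integrals of nonnegative functions, which need no integrability. *)
Lemma regression_posneg (R : realType) m (K : R.-pker (m.-tuple R) ~> R) x :
  (regression K x =
   \int[K x]_y (Num.max 0 y)%:E - \int[K x]_y (Num.max 0 (- y))%:E)%E.
Proof.
rewrite /regression integralE; congr (_ - _)%E; apply: eq_integral => y _.
  by rewrite funeposE EFin_max maxC.
by rewrite funenegE EFin_max maxC.
Qed.

Lemma integral_pker_cst d1 d2 (X : measurableType d1) (Y : measurableType d2)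
    (R : realType) (K : R.-pker X ~> Y) x (t : R) :
  (\int[K x]_y t%:E = t%:E)%E.
Proof. by rewrite integral_cst// [X in (_ * X)%E]prob_kernel mule1. Qed.

(* No integrability is assumed, so [regression K x] may be infinite (with the
   convention [+oo - +oo = -oo]). *)
Lemma regression_subl_le (R : realType) (m : nat)
    (K : R.-pker (m.-tuple R) ~> R) (t : R) (x : m.-tuple R) :
  0 <= t ->
  (regression K x - t%:E <= \int[K x]_y (Num.max 0 (y - t))%:E)%E.
Proof.
move=> t0.
rewrite leeBlDr// -[X in (_ + X)%E](integral_pker_cst K x) regression_posneg.
have msub : measurable_fun [set: R] (fun y : R => (Num.max 0 (y - t))%:E).
  by apply: measurable_maxr0; exact: measurable_funB.
have mid : measurable_fun [set: R] (fun y : R => (Num.max 0 y)%:E).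
  by apply: measurable_maxr0.
rewrite -ge0_integralD//=; last first.
  by move=> y _; rewrite lee_fin le_max lexx.
(* The negative part can be discarded, since already [y^+ <= (y - t)^+ + t] when [0 <= t]. *)
apply: (@le_trans _ _ (\int[K x]_y (Num.max 0 y)%:E)%E).
  rewrite -[leRHS]adde0 leeD2l// oppe_le0.
  by apply: integral_ge0 => y _; rewrite lee_fin le_max lexx.
apply: ge0_le_integral => //=.
- by move=> y _; rewrite lee_fin le_max lexx.
- exact: emeasurable_funD.
- move=> y _; rewrite -EFinD lee_fin.
  by rewrite /Num.max; case: ltP => ?; case: ltP => ?; lra.
Qed.

Lemma regression_subr_le (R : realType) (m : nat)
    (K : R.-pker (m.-tuple R) ~> R) (t : R) (x : m.-tuple R) :
  0 <= t ->
  (t%:E - regression K x <= \int[K x]_y (Num.max 0 (t - y))%:E)%E.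
Proof.
move=> t0; rewrite regression_posneg.
have msub : measurable_fun [set: R] (fun y : R => (Num.max 0 (t - y))%:E).
  by apply: measurable_maxr0; exact: measurable_funB.
have mid : measurable_fun [set: R] (fun y : R => (Num.max 0 y)%:E).
  exact: measurable_maxr0.
have mopp : measurable_fun [set: R] (fun y : R => (Num.max 0 (- y))%:E).
  by apply: measurable_maxr0; exact: measurable_funN.
have ge0 (f : R -> R) y : (0 <= (Num.max 0 (f y))%:E)%E.
  by rewrite lee_fin le_max lexx.
(* This decides the case where both parts of the regression are infinite: its value is then [-oo],
   and the right-hand side must be [+oo]. The next inequality gives no information there. *)
have : (\int[K x]_y (Num.max 0 (- y))%:E <=
    \int[K x]_y (Num.max 0 (t - y))%:E)%E.
  apply: ge0_le_integral => //= y _; rewrite lee_fin.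
  by rewrite /Num.max; case: ltP => ?; case: ltP => ?; lra.
(* Integrated form of [t + y^- <= y^+ + (t - y)^+], with every term moved to the side where it is
   nonnegative. *)
have : (t%:E + \int[K x]_y (Num.max 0 (- y))%:E <=
    \int[K x]_y (Num.max 0 y)%:E + \int[K x]_y (Num.max 0 (t - y))%:E)%E.
  rewrite -(integral_pker_cst K x) -!ge0_integralD//=;
    try by move=> y _; rewrite lee_fin le_max lexx.
  apply: ge0_le_integral => //=.
  - by move=> y _; rewrite adde_ge0.
  - exact: emeasurable_funD.
  - exact: emeasurable_funD.
  - move=> y _; rewrite -!EFinD lee_fin.
    by rewrite /Num.max; case: ltP => ?; case: ltP => ?; case: ltP => ?; lra.
have P0 : (0 <= \int[K x]_y (Num.max 0 y)%:E)%E
  by apply: integral_ge0 => y _; rewrite lee_fin le_max lexx.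
have N0 : (0 <= \int[K x]_y (Num.max 0 (- y))%:E)%E
  by apply: integral_ge0 => y _; rewrite lee_fin le_max lexx.
move: P0 N0.
case: (integral (K x) setT (fun y => (Num.max 0 y)%:E)) => [p| |] //;
case: (integral (K x) setT (fun y => (Num.max 0 (- y))%:E)) => [n| |] //;
case: (integral (K x) setT (fun y => (Num.max 0 (t - y))%:E)) => [i| |] //=;
by rewrite -?EFinN -?EFinD ?lee_fin ?leey ?leNye// => *; lra.
Qed.

Lemma measurable_regression (R : realType) m (K : R.-pker (m.-tuple R) ~> R) :
  measurable_fun [set: m.-tuple R] (regression K).
Proof.
rewrite (_ : regression K = fun x => (\int[K x]_y (Num.max 0 y)%:E -
    \int[K x]_y (Num.max 0 (- y))%:E)%E); last first.
  by apply/funext => x; rewrite regression_posneg.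
have mk U : measurable U -> measurable_fun [set: m.-tuple R] (K ^~ U).
  exact: measurable_kernel.
apply: emeasurable_funB; apply: measurable_fun_integral_kernel => //.
- by move=> y; rewrite lee_fin le_max lexx.
- exact: measurable_maxr0.
- by move=> y; rewrite lee_fin le_max lexx.
- by apply: measurable_maxr0; exact: measurable_funN.
Qed.

Lemma measurable_regression_ge (R : realType) (m : nat)
    (K : R.-pker (m.-tuple R) ~> R) (b : R) :
  measurable [set x | (b%:E <= regression K x)%E].
Proof.
rewrite -[X in measurable X]setTI.
by apply: emeasurable_fun_c_infty => //; exact: measurable_regression.
Qed.

Lemma measurable_regression_le (R : realType) (m : nat)
    (K : R.-pker (m.-tuple R) ~> R) (b : R) :
  measurable [set x | (regression K x <= b%:E)%E].
Proof.
rewrite -[X in measurable X]setTI.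
by apply: emeasurable_fun_infty_c => //; exact: measurable_regression.
Qed.

(** * Bounds for the two tails *)

Lemma regression_ge_bound (R : realType) (m : nat)
    (muA : probability (m.-tuple R) R)
    (muC : probability (m.-tuple R * R)%type R)
    (K : R.-pker (m.-tuple R) ~> R) (a : R) :
  is_copula_measure_split muC -> is_markov_kernel_of muC muA K -> a <= 2^-1 ->
  (muA [set x | ((2^-1 + a)%:E <= regression K x)%E] <= (1 - 2 * a)%:E)%E.
Proof.
move=> hC hK ha1; set S := [set x | _].
have mS : measurable S by exact: measurable_regression_ge.
pose u := fine (muA S).
have uE : muA S = u%:E by rewrite fineK//; exact: fin_num_measure.
have u0 : 0 <= u by exact: fine_ge0.
have u1 : u <= 1 by rewrite -lee_fin -uE; exact: probability_le1.
rewrite uE lee_fin.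
(* By contradiction: [u > 1 - 2 * a >= 0] makes [u] positive, so that the level [1 - u] is below 1,
   the constant [2^-1 + a - (1 - u)] is nonnegative, and the final inequality can be divided by
   [u]. *)
rewrite leNgt; apply/negP => ult.
have := @copula_kernel_markov _ _ _ _ _
  (fun y => (Num.max 0 (y - (1 - u)))%:E) S
  (2^-1 + a - (1 - u)) hC hK _ _ mS _ _.
rewrite integral_maxr0_subl ?subr_ge0//; last lra.
rewrite uE -EFinM lee_fin.
have -> : 1 - (1 - u) = u by ring.
move=> H; suff : (2^-1 + a - (1 - u)) * u <= u ^+ 2 / 2 by nra.
apply: H.
- by move=> y; rewrite lee_fin le_max lexx.
- by apply: measurable_maxr0; exact: measurable_funB.
- lra.
- move=> x Sx; apply: (@le_trans _ _ (regression K x - (1 - u)%:E)%E).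
    by rewrite EFinB leeB.
  by apply: regression_subl_le; rewrite subr_ge0.
Qed.

Lemma regression_le_bound (R : realType) (m : nat)
    (muA : probability (m.-tuple R) R)
    (muC : probability (m.-tuple R * R)%type R)
    (K : R.-pker (m.-tuple R) ~> R) (a : R) :
  is_copula_measure_split muC -> is_markov_kernel_of muC muA K -> a <= 2^-1 ->
  (muA [set x | (regression K x <= (2^-1 - a)%:E)%E] <= (1 - 2 * a)%:E)%E.
Proof.
move=> hC hK ha1; set S := [set x | _].
have mS : measurable S by exact: measurable_regression_le.
pose l := fine (muA S).
have lE : muA S = l%:E by rewrite fineK//; exact: fin_num_measure.
have l0 : 0 <= l by exact: fine_ge0.
have l1 : l <= 1 by rewrite -lee_fin -lE; exact: probability_le1.
rewrite lE lee_fin.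
rewrite leNgt; apply/negP => llt.
(* The level is now [t = l], the mirror image of [1 - u]; the integral over the unit interval is
   again half the square of the measure. *)
have := @copula_kernel_markov _ _ _ _ _ (fun y => (Num.max 0 (l - y))%:E) S
  (l - (2^-1 - a)) hC hK _ _ mS _ _.
rewrite integral_maxr0_subr//; last lra.
rewrite lE -EFinM lee_fin.
move=> H; suff : (l - (2^-1 - a)) * l <= l ^+ 2 / 2 by nra.
apply: H.
- by move=> y; rewrite lee_fin le_max lexx.
- by apply: measurable_maxr0; exact: measurable_funB.
- lra.
- move=> x Sx; apply: (@le_trans _ _ (l%:E - regression K x)%E).
    by rewrite EFinB leeB.
  exact: regression_subr_le.
Qed.

(** * Union of the two tails *)

Unset Implicit Arguments.
Set Strict Implicit.

Theorem theorem12 (R : realType) (d : nat) (hd : (2 <= d)%N)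
  (muA : probability ((d.-1).-tuple R) R)
  (muC : probability ((d.-1).-tuple R * R)%type R)
  (K : R.-pker ((d.-1).-tuple R) ~> R)
  (hA : is_copula_measure muA)
  (hC : is_copula_measure_split muC)
  (hCA : has_marginal muC muA)
  (hK : is_markov_kernel_of muC muA K)
  (a : R) (ha0 : 0 <= a) (ha1 : a <= 2^-1) :
  (muA [set x | (a%:E <= `| regression K x - (2^-1)%:E |)%E]
     <= (Num.min 1 (2 - 4 * a))%:E)%E.
Proof.
have mge := measurable_regression_ge K (2^-1 + a).
have mle := measurable_regression_le K (2^-1 - a).
have -> : [set x | (a%:E <= `| regression K x - (2^-1)%:E |)%E] =
    [set x | ((2^-1 + a)%:E <= regression K x)%E] `|`
    [set x | (regression K x <= (2^-1 - a)%:E)%E].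
  (* Infinite values are at infinite distance from 1/2: [+oo] lies in the upper tail and [-oo] in
     the lower one. *)
  apply/seteqP; split=> x /=; case: (regression K x) => [r| |] //=;
    rewrite ?leey ?leNye ?lee_fin; try by [left|right|].
  - by rewrite ler_normr => /orP[h|h]; [left|right]; lra.
  - by rewrite ler_normr => -[h|h]; apply/orP; [left|right]; lra.
case: (leP 1 (2 - 4 * a)) => _.
  by apply: probability_le1; exact: measurableU.
apply: (le_trans (measureU2 muA mge mle)).
have -> : (2 - 4 * a)%:E = ((1 - 2 * a)%:E + (1 - 2 * a)%:E)%E.
  by rewrite -EFinD; congr (_%:E); ring.
apply: leeD.
  exact: regression_ge_bound hC hK ha1.
exact: regression_le_bound hC hK ha1.
Qed.
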